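(* Let $d\ge2$. If $a+b=0$, then there exists an $\alpha<0$ such that: (1) there is a positive gap between the top two eigenvalues of the re-weighted uncentered covariance matrix $\tilde\Sigma=\mathbb{E}_{x\sim P}\,e^{\alpha\|x\|^2}(xx^\top)$, that is, $\lambda_1(\tilde\Sigma)>\lambda_2(\tilde\Sigma)$; and (2) the top eigenvector of $\tilde\Sigma$ is $u$.
   Context: Let $\epsilon>0$ and let $q$ be a symmetric (about $0$) one-dimensional isotropic (mean $0$, variance $1$) logconcave density. Let $a<b$ satisfy $q((-\infty,a])\ge\epsilon$, $q([a,b])\ge\epsilon$, $q([b,\infty))\ge\epsilon$, where $q(I)=\int_I q$. Let $\tilde q$ be $q$ restricted to $\mathbb{R}\setminus[a,b]$ and renormalized, and let $\hat q$ be the isotropized density, i.e. the density of $(X-\mu_1)/\sigma_1$ for $X\sim\tilde q$, where $\mu_1,\sigma_1^2$ are the mean and variance of $\tilde q$. Let $P=\hat q\otimes q\otimes\cdots\otimes q$ on $\mathbb{R}^d$ (one copy of $\hat q$, $d-1$ copies of $q$), and let $u=e_1$ be the unit vector normal to the margin. $\|\cdot\|$ is the Euclidean norm, and $\lambda_1\ge\lambda_2\ge\cdots$ denote eigenvalues in decreasing order. *)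

(* Defs.v *)
From HB Require Import structures.
From mathcomp Require Import all_boot all_order all_algebra.
From mathcomp Require Import all_classical all_reals all_analysis.
From mathcomp Require Import measurable_realfun.

Set Implicit Arguments.
Unset Strict Implicit.
Unset Printing Implicit Defensive.

Import Order.TTheory GRing.Theory Num.Theory.
Import numFieldNormedType.Exports.

Local Open Scope classical_set_scope.
Local Open Scope ring_scope.

Record density (R : realType) := Density {
  density_fun :> R -> R ;
  density_measurable : measurable_fun [set: R] density_fun ;
  density_ge0 : forall x, 0 <= density_fun x ;
  density_integral :
    (\int[@lebesgue_measure R]_x (density_fun x)%:E = 1)%E }.

Definition density_prob (R : realType) (q : density R)
    : set (measurableTypeR R) -> \bar R :=
  fun A => (\int[lebesgue_measure]_(x in A) (q x)%:E)%E.

Section density_prob.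
Context (R : realType) (q : density R).

Let density_prob0 : density_prob q set0 = 0%E.
Proof. by rewrite /density_prob integral_set0. Qed.

Let density_prob_ge0 A : (0 <= density_prob q A)%E.
Proof. by apply: integral_ge0 => x _; rewrite lee_fin density_ge0. Qed.

Let density_prob_sigma_additive : semi_sigma_additive (density_prob q).
Proof.
move=> /= F mF tF mUF; rewrite /density_prob; apply: cvg_toP.
  apply: ereal_nondecreasing_is_cvgn => m n mn.
  apply: lee_sum_nneg_natr => // k _ _.
  by apply: integral_ge0 => /= x _; rewrite lee_fin density_ge0.
rewrite ge0_integral_bigcup//=.
- apply/measurable_EFinP; apply: measurable_funTS.
  exact: density_measurable.
- by move=> x _; rewrite lee_fin density_ge0.
Qed.

HB.instance Definition _ := isMeasure.Build _ _ _ (density_prob q)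
  density_prob0 density_prob_ge0 density_prob_sigma_additive.

Let density_prob_setT : density_prob q [set: _] = 1%:E.
Proof. exact: density_integral. Qed.

HB.instance Definition _ := @Measure_isProbability.Build _ _ R
  (density_prob q) density_prob_setT.

End density_prob.

(** [0 `^ 0 = 1] and [0 `^ t = 0] for [t != 0], so the inequality is the usual
    one with [ln 0 = -oo]. *)
Definition logconcave (R : realType) (q : R -> R) :=
  forall x y t : R, 0 <= t <= 1 ->
    q x `^ t * q y `^ (1 - t) <= q (t * x + (1 - t) * y).

Definition isotropic (R : realType) (P : probability (measurableTypeR R) R) :=
  ('E_P[fun x : R => x] = 0)%E /\ ('V_P[fun x : R => x] = 1)%E.

Section margin.
Context (R : realType).
Implicit Types P : probability (measurableTypeR R) R.

Lemma measurable_margin (a b : R) :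
  measurable (~` `[a, b] : set (measurableTypeR R)).
Proof. by apply: measurableC; exact: measurable_itv. Qed.

(** The second argument of [mnormalize] is a default value, used only when the
    restricted measure is null. *)
Definition remove_margin P (a b : R) : probability (measurableTypeR R) R :=
  mnormalize (mrestr P (measurable_margin a b)) P.

Definition standardize P (x : measurableTypeR R) : measurableTypeR R :=
  (x - fine 'E_P[fun y : R => y]) / Num.sqrt (fine 'V_P[fun y : R => y]).

Let measurable_standardize P : measurable_fun setT (standardize P).
Proof.
by apply: measurable_funM => //; apply: measurable_funB => //; exact: measurable_id.
Qed.

HB.instance Definition _ P := isMeasurableFun.Build _ _ _ _ (standardize P)
  (measurable_standardize P).

Definition isotropize P : probability (measurableTypeR R) R :=
  distribution P (standardize P).

End margin.

Definition cons_pair (T : Type) n (x : T * n.-tuple T) : n.+1.-tuple T :=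
  [tuple of x.1 :: x.2].

Section product_prob.
Context (R : realType) (d : measure_display) (T : measurableType d).

Let measurable_cons_pair n : measurable_fun setT (@cons_pair T n).
Proof. exact: measurable_cons. Qed.

HB.instance Definition _ n := isMeasurableFun.Build _ _ _ _ (@cons_pair T n)
  (@measurable_cons_pair n).

Fixpoint product_prob n : ('I_n -> probability T R) ->
    probability (n.-tuple T) R :=
  match n with
  | 0 => fun _ => \d_([tuple] : 0.-tuple T)
  | n'.+1 => fun m =>
      distribution (m ord0 \x product_prob (fun i => m (lift ord0 i)))%E
        (@cons_pair T n')
  end.

End product_prob.

Section product_prob_box.
Local Open Scope ereal_scope.
Context (R : realType) (d : measure_display) (T : measurableType d).

Lemma product_prob_box n (m : 'I_n -> probability T R) (A : 'I_n -> set T) :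
  (forall i, measurable (A i)) ->
  product_prob m [set x | forall i, A i (tnth x i)] = \prod_(i < n) m i (A i).
Proof.
elim: n m A => [|n IHn] m A mA /=.
  rewrite big_ord0 diracE mem_set//= => -[]//.
rewrite big_ord_recl /distribution /pushforward /=.
rewrite -(IHn (fun i => m (lift ord0 i)) (fun i => A (lift ord0 i)))//.
rewrite -product_measure1E//; last first.
  rewrite [X in measurable X](_ : _ = \bigcap_(i in [set: 'I_n])
      ((@tnth n T ^~ i) @^-1` A (lift ord0 i))); last first.
    by apply/seteqP; split => x /= h i; [move=> _|]; exact: h.
  apply: fin_bigcap_measurable => // i _.
  by rewrite -[X in measurable X]setTI; exact: measurable_tnth.
congr (_ _); apply/seteqP; split => -[y x] /=.
  move=> h; split; first by have := h ord0; rewrite tnth0.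
  by move=> i; have := h (lift ord0 i); rewrite tnthS.
by move=> [h0 h] i; case: (unliftP ord0 i) => [j|] ->; rewrite ?tnthS ?tnth0.
Qed.

End product_prob_box.

Definition vec (R : realType) n (x : n.-tuple (measurableTypeR R)) : 'cV[R]_n :=
  \col_(i < n) tnth x i.

(** The library norm on matrices is the sup norm, hence this definition. *)
Definition euclidean_norm (R : realType) n (v : 'cV[R]_n) : R :=
  Num.sqrt (\sum_(i < n) v i ord0 ^+ 2).

Definition reweighted_cov (R : realType) n
    (P : probability (n.-tuple (measurableTypeR R)) R) (alpha : R) : 'M[R]_n :=
  \matrix_(i < n, j < n)
    fine 'E_P[fun x => (expR (alpha * euclidean_norm (vec x) ^+ 2)
                        *: (vec x *m (vec x)^T)) i j].

(** Eigenvalues with algebraic multiplicity, in decreasing order; the default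
    [[::]] is used only when the characteristic polynomial does not split, which
    does not happen for real symmetric matrices. *)
Definition eigenvalues (R : realType) n (A : 'M[R]_n) : seq R :=
  sort >=%R (xget [::] [set s : seq R |
    char_poly A = \prod_(z <- s) ('X - z%:P)]).

(** Numbered from [1]. *)
Definition eigenvalue_nth (R : realType) n (A : 'M[R]_n) (k : nat) : R :=
  (eigenvalues A)`_k.-1.

(** Up to a nonzero scalar, [u] is the only eigenvector of [A] for its largest
    eigenvalue. *)
Definition is_the_top_eigenvector (R : realType) n (A : 'M[R]_n) (u : 'cV[R]_n) :=
  u != 0 /\
  forall v : 'cV[R]_n,
    A *m v = eigenvalue_nth A 1 *: v <-> exists c : R, v = c *: u.

Definition margin_normal (R : realType) n : 'cV[R]_n :=
  \col_(i < n) (i == 0%N :> nat)%:R.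

Definition margin_product (R : realType) (q : density R) (a b : R) n
    : probability (n.-tuple (measurableTypeR R)) R :=
  product_prob (fun i : 'I_n =>
    if i == 0%N :> nat then isotropize (remove_margin (density_prob q) a b)
    else density_prob q : probability (measurableTypeR R) R).

(* Main.v *)
(** By independence and the symmetry of [q], the reweighted covariance is
    diagonal. With [w x = exp (alpha x^2)], its entry along [e_1] exceeds the
    other ones iff the ratio [E(x^2 w) / E(w)] is larger under [\hat q] than
    under [q]. Rather than expanding at [alpha = 0] (which would require
    comparing fourth moments), let [alpha] tend to [-oo]: [\hat q] is carried by
    [x^2 >= c] with [c = b^2 / sigma_1^2 > 0], so that its ratio is at least
    [c] for all [alpha], whereas [q], being unimodal, charges every
    neighbourhood of [0], so that its ratio tends to [0]. *)
Require Import Defs.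
From HB Require Import structures.
From mathcomp Require Import all_boot all_order all_algebra.
From mathcomp Require Import all_classical all_reals all_analysis.
From mathcomp Require Import ring lra measurable_realfun.
Import Order.TTheory GRing.Theory Num.Theory.
Import numFieldNormedType.Exports.
Local Open Scope classical_set_scope.
Local Open Scope ring_scope.

(** * Measurability of the sublevel sets of the square *)

Lemma measurable_sqr_le (R : realType) (c : R) :
  measurable [set x : measurableTypeR R | x ^+ 2 <= c].
Proof.
rewrite -[X in measurable X]setTI.
by apply: measurable_fun_le => //; exact: measurable_funX.
Qed.

Lemma measurable_sqr_lt (R : realType) (c : R) :
  measurable [set x : measurableTypeR R | x ^+ 2 < c].
Proof.
rewrite [X in measurable X](_ : _ = ~` [set x : R | c <= x ^+ 2]); last first.
  by apply/seteqP; split => x /=; rewrite ltNge => /negP.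
apply: measurableC; rewrite -[X in measurable X]setTI.
by apply: measurable_fun_le => //; exact: measurable_funX.
Qed.

(** * Spectrum of a diagonal matrix *)

(** The diagonal is one list of roots of the characteristic polynomial; by unique factorization the
    list picked by [xget] is a permutation of it, and sorting identifies the two. *)
Lemma eigenvalues_diag_mx (R : realType) n (D : 'rV[R]_n) :
  eigenvalues (diag_mx D) = sort >=%R [seq D ord0 i | i <- enum 'I_n].
Proof.
have charD : char_poly (diag_mx D) =
    \prod_(z <- [seq D ord0 i | i <- enum 'I_n]) ('X - z%:P).
  rewrite big_map char_poly_trig ?diag_mx_is_trig// -big_enum.
  by apply: eq_bigr => i _; rewrite mxE eqxx mulr1n.
rewrite /eigenvalues; case: xgetP => [s _ /= sD|/(_ _ charD)//].
apply/perm_sortP.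
- by move=> x y; exact: ge_total.
- by move=> y x z /= yx zy; exact: le_trans zy yx.
- by move=> x y /andP[/= yx xy]; apply/eqP; rewrite eq_le xy yx.
by rewrite prod_XsubC_eq// -sD.
Qed.

(** Off the coordinate [ord0], an eigenvector for [lam] satisfies [(mu - lam) * v i = 0]. As
    [2 <= n], the second eigenvalue is a genuine [mu], not the default of [nth]. *)
Lemma margin_normal_top_eigenvector (R : realType) n (lam mu : R) :
    (2 <= n)%N -> mu < lam ->
  let S := diag_mx (\row_(i < n) if i == 0%N :> nat then lam else mu) in
  eigenvalue_nth S 2 < eigenvalue_nth S 1 /\
  is_the_top_eigenvector S (margin_normal R n).
Proof.
case: n => [|[|n]]// _ mulam S.
have eigS : eigenvalues S = lam :: mu :: nseq n mu.
  rewrite /S eigenvalues_diag_mx.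
  have -> : [seq (\row_(i < n.+2) if i == 0%N :> nat then lam else mu) ord0 i
      | i <- enum 'I_n.+2] = lam :: nseq n.+1 mu.
    apply: (@eq_from_nth _ 0) => [|i].
      by rewrite size_map size_enum_ord /= size_nseq.
    rewrite size_map size_enum_ord => ni.
    rewrite (nth_map ord0) ?size_enum_ord// mxE nth_enum_ord//.
    by case: i ni => // i ni; rewrite [RHS]nth_nseq -ltnS ni.
  apply: sorted_sort => //=; first by move=> y x z /= yx zy; exact: le_trans zy yx.
  rewrite ltW//=.
  by elim: n {S} => //= n IHn; rewrite lexx.
rewrite /is_the_top_eigenvector /eigenvalue_nth eigS /=; split => //; split.
  by apply/eqP => /matrixP/(_ ord0 ord0)/eqP; rewrite !mxE/= oner_eq0.
move=> v; split=> [Sv|[c ->]].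
  exists (v ord0 ord0); apply/matrixP => i j; rewrite ord1 !mxE.
  move/matrixP/(_ i ord0) : Sv; rewrite mul_diag_mx !mxE.
  have [i0 _|i0 /eqP] := eqVneq (i : nat) 0%N.
    by rewrite mulr1; congr (v _ _); apply/val_inj.
  rewrite -subr_eq0 -mulrBl mulf_eq0 subr_eq0 lt_eqF//= => /eqP ->.
  by rewrite mulr0.
apply/matrixP => i j; rewrite mul_diag_mx !mxE.
by case: ifPn; rewrite ?mulr0.
Qed.

(** * Integrals of products under a product probability *)

Lemma bounded_integrable d (T : measurableType d) (R : realType)
    (P : probability T R) (f : T -> R) (M : R) :
    measurable_fun setT f -> (forall x, `|f x| <= M) ->
  P.-integrable setT (EFin \o f).
Proof.
move=> mf fM; apply: measurable_bounded_integrable => //.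
  by rewrite (le_lt_trans (probability_le1 _ _)) ?ltry.
by exists M; split; [exact: num_real|move=> x Mx y _; exact/(le_trans (fM y))/ltW].
Qed.

(** Fubini, one coordinate at a time; the uniform bound [M] keeps every partial product
    integrable. *)
Lemma integral_product_prob (R : realType) d (T : measurableType d) n
    (m : 'I_n -> probability T R) (f : 'I_n -> T -> R) (M : R) :
    (forall i, measurable_fun setT (f i)) -> (forall i x, `|f i x| <= M) ->
  (\int[product_prob m]_x (\prod_(i < n) f i (tnth x i))%:E)%E =
  (\prod_(i < n) \int[m i]_x f i x)%:E.
Proof.
move=> mf fM.
have mprod k (g : 'I_k -> T -> R) : (forall i, measurable_fun setT (g i)) ->
    measurable_fun setT (fun x : k.-tuple T => \prod_(i < k) g i (tnth x i)).
  move=> mg; apply: measurable_prod => i _.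
  by apply: (measurableT_comp (mg i)); exact: measurable_tnth.
have prodM k (g : 'I_k -> T -> R) : (forall i x, `|g i x| <= M) ->
    forall x : k.-tuple T, `|\prod_(i < k) g i (tnth x i)| <= M ^+ k.
  move=> gM x; rewrite normr_prod -[in leRHS](card_ord k) -prodr_const.
  by apply: ler_prod => i _; rewrite normr_ge0 gM.
elim: n m f mf fM => [|n IHn] m f mf fM.
  rewrite big_ord0; under eq_integral do rewrite big_ord0.
  by rewrite integral_cst//= diracT mule1.
pose F (x : n.+1.-tuple T) := \prod_(i < n.+1) f i (tnth x i).
have mF : measurable_fun setT F by exact: mprod.
pose f' i := f (lift ord0 i); pose m' i := m (lift ord0 i).
pose G (z : T * n.-tuple T) := f ord0 z.1 * \prod_(i < n) f' i (tnth z.2 i).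
have FG z : F (cons_pair z) = G z.
  rewrite /F /G big_ord_recl tnth0; congr (_ * _).
  by apply: eq_bigr => i _; rewrite tnthS.
have mG : measurable_fun setT G.
  apply: measurable_funM.
    by apply: (measurableT_comp (mf ord0)); exact: measurable_fst.
  have mf' : forall i, measurable_fun setT (f' i) by move=> i; exact: mf.
  by apply: (measurableT_comp (mprod _ f' mf')).
have intG : (m ord0 \x product_prob m')%E.-integrable setT (EFin \o G).
  apply: (@bounded_integrable _ _ _ _ _ (M ^+ n.+1)) => // z; rewrite -FG.
  exact: prodM.
rewrite /= integral_distribution; last 2 first.
- exact/measurable_EFinP.
- apply: eq_integrable intG => // z _; rewrite /= -FG//.
under eq_integral do rewrite /= -/(F _) FG.
rewrite -(integral12_prod_meas1 intG)/= /fubini_F/=.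
pose c := \prod_(i < n) \int[m' i]_x f' i x.
transitivity (\int[m ord0]_x ((f ord0 x)%:E * c%:E))%E.
  apply: eq_integral => x _; rewrite -(IHn m' f')//; last 2 first.
  - by move=> i; exact: mf.
  - by move=> i y; exact: fM.
  rewrite -integralZl//.
  apply: (@bounded_integrable _ _ _ _ _ (M ^+ n)); first by apply: mprod => i; exact: mf.
  by apply: prodM => i y; exact: fM.
have int0 := bounded_integrable _ _ _ (m ord0) _ _ (mf ord0) (fM ord0).
rewrite integralZr// big_ord_recl EFinM; congr (_ * _)%E.
by rewrite /Rintegral fineK// integrable_fin_num.
Qed.

(** * Moments under a Gaussian weight *)

Definition gaussian_moment (R : realType)
    (P : probability (measurableTypeR R) R) (alpha : R) (k : nat) : R :=
  \int[P]_x (x ^+ k * expR (alpha * x ^+ 2)).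

Lemma measurable_gaussian_moment (R : realType) (alpha : R) k :
  measurable_fun [set: measurableTypeR R]
    (fun x : R => x ^+ k * expR (alpha * x ^+ 2)).
Proof.
apply: measurable_funM; first exact: measurable_funX.
apply: measurableT_comp; first exact: measurable_expR.
by apply: measurable_funM => //; exact: measurable_funX.
Qed.

(** [t <= expR t] at [t = - alpha * x ^+ 2] controls [x ^+ 2 * w], and [1 + x ^+ 2] dominates the
    powers up to 2. The weighted moments are thus finite under every probability. *)
Lemma gaussian_moment_bound (R : realType) (alpha x : R) k :
    alpha < 0 -> (k <= 2)%N ->
  `|x ^+ k * expR (alpha * x ^+ 2)| <= 1 + (- alpha)^-1.
Proof.
move=> alpha0 k2; set w := expR _.
have x20 : 0 <= x ^+ 2 by exact: sqr_ge0.
have w0 : 0 < w by exact: expR_gt0.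
have w1 : w <= 1 by rewrite -expR0 ler_expR; nra.
have x2w : x ^+ 2 * w <= (- alpha)^-1.
  rewrite -[leRHS]mul1r ler_pdivlMr ?oppr_gt0//
    -[leRHS](@expRxMexpNx_1 _ (- (alpha * x ^+ 2))) opprK -/w.
  have := expR_ge1Dx (- (alpha * x ^+ 2)); nra.
rewrite normrM (gtr0_norm w0) normrX.
apply: (@le_trans _ _ ((1 + x ^+ 2) * w)); last by nra.
rewrite ler_pM2r// -(real_normK (num_real x)).
have := normr_ge0 x; move: k k2 => [|[|[|//]]] _ xx; rewrite ?expr0 ?expr1; nra.
Qed.

Lemma integrable_gaussian_moment (R : realType)
    (P : probability (measurableTypeR R) R) (alpha : R) k :
    alpha < 0 -> (k <= 2)%N ->
  P.-integrable setT (EFin \o (fun x : R => x ^+ k * expR (alpha * x ^+ 2))).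
Proof.
move=> alpha0 k2; apply: bounded_integrable.
  exact: measurable_gaussian_moment.
by move=> x; exact: gaussian_moment_bound.
Qed.

(** The weight is positive everywhere, so a zero integral would make the whole line a null set. *)
Lemma gaussian_moment0_gt0 (R : realType)
    (P : probability (measurableTypeR R) R) (alpha : R) :
  alpha < 0 -> 0 < gaussian_moment R P alpha 0.
Proof.
move=> alpha0; rewrite lt_neqAle; apply/andP; split; last first.
  by apply: Rintegral_ge0 => x _; rewrite mulr_ge0// expR_ge0.
apply/negP => /eqP/esym gm0.
have intw := integrable_gaussian_moment _ P _ 0 alpha0 isT.
have /(ae_eq_integral_abs _ measurableT (measurable_int _ intw)) [N [_ PN wN]] :
    (\int[P]_x `|(EFin \o (fun x : R => x ^+ 0 * expR (alpha * x ^+ 2))%R) x| = 0)%E.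
  under eq_integral => x _ do rewrite gee0_abs ?lee_fin ?mulr_ge0 ?expR_ge0//.
  rewrite -(fineK (integrable_fin_num measurableT intw)).
  by rewrite -[fine _]/(gaussian_moment _ _ _ _) gm0.
have NT : N = setT.
  apply/seteqP; split => // x _; apply: wN => /(_ I)/eqP.
  by rewrite /= eqe mul1r gt_eqF// expR_gt0.
by have := probability_setT P; rewrite -NT PN => /eqP; rewrite lt_eqF.
Qed.

(** The lower bound used for \hat q: [c <= x ^+ 2] holds almost everywhere, and the weight preserves
    it. *)
Lemma gaussian_moment_ge (R : realType)
    (P : probability (measurableTypeR R) R) (c alpha : R) :
    alpha < 0 -> 0 <= c -> P [set x : R | x ^+ 2 < c] = 0%E ->
  c * gaussian_moment R P alpha 0 <= gaussian_moment R P alpha 2.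
Proof.
move=> alpha0 c0 Pc.
have int k := integrable_gaussian_moment _ P alpha k alpha0.
rewrite /gaussian_moment -RintegralZl//; last exact: int.
have mc : measurable [set x : measurableTypeR R | x ^+ 2 < c].
  exact: measurable_sqr_lt.
apply: fine_le.
- apply: integrable_fin_num => //=; under eq_fun do rewrite EFinM.
  by apply: integrableZl => //; exact: int.
- by apply: integrable_fin_num => //=; exact: int.
apply: ae_ge0_le_integral => //.
- by move=> x _; rewrite lee_fin !mulr_ge0// expR_ge0.
- by apply/measurable_EFinP/measurable_funM => //; exact: measurable_gaussian_moment.
- by move=> x _; rewrite lee_fin mulr_ge0 ?sqr_ge0// expR_ge0.
- by apply/measurable_EFinP; exact: measurable_gaussian_moment.
exists [set x | x ^+ 2 < c]; split => // x /= xc; rewrite ltNge; apply/negP => cx.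
by apply: xc => _; rewrite lee_fin mul1r ler_wpM2r// expR_ge0.
Qed.

(** The upper bound used for q: for very negative [alpha], the weight beyond [x ^+ 2 = c] is
    negligible against the weight on [x ^+ 2 <= c / 4], and the second moment controls the tail. *)
Lemma gaussian_moment_lt (R : realType)
    (Q : probability (measurableTypeR R) R) (c : R) :
    0 < c -> Q.-integrable setT (fun x : R => (x ^+ 2)%:E) ->
    (0 < Q [set x : R | (x ^+ 2 <= c / 4)%R])%E ->
  exists2 alpha, alpha < 0 &
    gaussian_moment R Q alpha 2 < c * gaussian_moment R Q alpha 0.
Proof.
move=> c0 intQ Qc.
set B := [set x : R | x ^+ 2 <= c / 4] in Qc.
have mB : measurable (B : set (measurableTypeR R)).
  exact: measurable_sqr_le.
pose p := fine (Q B).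
have p0 : 0 < p by rewrite fine_gt0// Qc/= (le_lt_trans (probability_le1 _ _)) ?ltry.
pose v := \int[Q]_x (x ^+ 2).
have v0 : 0 <= v by apply: Rintegral_ge0 => x _; exact: sqr_ge0.
(* On [B], [c - x ^+ 2] is at least [3 * c / 4], whence [kappa]. Since [1 + s <= expR s], the [s]
   below gives [v * expR (- s) < kappa], and [alpha] solves [alpha * c = - s + alpha * (c / 4)]. *)
pose kappa := 3 * c / 4 * p.
have kappa0 : 0 < kappa by rewrite /kappa; nra.
pose s := (v + 1) / kappa.
have s0 : 0 < s by rewrite divr_gt0// ltr_wpDl.
pose alpha := - (4 * s / (3 * c)).
have alpha0 : alpha < 0 by rewrite oppr_lt0 divr_gt0// mulr_gt0.
exists alpha => //.
have int k := integrable_gaussian_moment _ Q alpha k alpha0.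
(* [f <= g] says [(c - x^2) w >= (3c/4) e^(alpha c/4) 1_B - x^2 e^(alpha c)]
   with [w = e^(alpha x^2)]. For the chosen [alpha], the term in [1_B]
   outweighs the error [v e^(alpha c)] after integration. *)
pose f (x : R) := 3 * c / 4 * expR (alpha * (c / 4)) * \1_B x +
  x ^+ 2 * expR (alpha * x ^+ 2).
pose g (x : R) := c * (x ^+ 0 * expR (alpha * x ^+ 2)) + expR (alpha * c) * x ^+ 2.
have fg x : f x <= g x.
  rewrite /f /g expr0 mul1r indicE.
  have w0 := expR_gt0 (alpha * x ^+ 2); have wc0 := expR_gt0 (alpha * c).
  have x20 := sqr_ge0 x.
  have [xB|xB] := boolP (x \in B).
    rewrite mulr1; move: xB; rewrite inE /B/= => xc.
    have : expR (alpha * (c / 4)) <= expR (alpha * x ^+ 2) by rewrite ler_expR; nra.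
    nra.
  rewrite mulr0 add0r.
  (* Off [B], either [c - x ^+ 2] is nonnegative or the weight is at most [expR (alpha * c)]. *)
  have [xc|cx] := leP (x ^+ 2) c; first by nra.
  have : expR (alpha * x ^+ 2) <= expR (alpha * c) by rewrite ler_expR; nra.
  nra.
have int1 : Q.-integrable setT (EFin \o \1_B) by exact: integrable_indic.
have intf1 : Q.-integrable setT
    (EFin \o (fun x => 3 * c / 4 * expR (alpha * (c / 4)) * \1_B x)).
  exact: (integrableZl measurableT _ int1).
have intg1 : Q.-integrable setT
    (EFin \o (fun x : R => c * (x ^+ 0 * expR (alpha * x ^+ 2)))).
  exact: (integrableZl measurableT _ (int 0%N isT)).
have intg2 : Q.-integrable setT (EFin \o (fun x : R => expR (alpha * c) * x ^+ 2)).
  exact: (integrableZl measurableT _ intQ).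
have intf : Q.-integrable setT (EFin \o f).
  exact: (integrableD measurableT intf1 (int 2%N isT)).
have intg : Q.-integrable setT (EFin \o g).
  exact: (integrableD measurableT intg1 intg2).
have : \int[Q]_x f x <= \int[Q]_x g x by apply: le_Rintegral.
have -> : \int[Q]_x f x = 3 * c / 4 * expR (alpha * (c / 4)) * \int[Q]_x \1_B x +
    gaussian_moment R Q alpha 2.
  rewrite /f RintegralD//; last exact: int.
  by congr (_ + _); exact: RintegralZl.
have -> : \int[Q]_x g x = c * gaussian_moment R Q alpha 0 + expR (alpha * c) * v.
  rewrite /g RintegralD//; congr (_ + _); last exact: RintegralZl.
  by apply: RintegralZl => //; exact: int.
have -> : \int[Q]_x \1_B x = p.
  by rewrite /Rintegral integral_indic// setIT.
have -> : expR (alpha * c) = expR (- s) * expR (alpha * (c / 4)).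
  by rewrite -expRD; congr expR; rewrite /alpha; field; rewrite gt_eqF.
have e0 := expR_gt0 (alpha * (c / 4)).
have : v * expR (- s) < kappa.
  apply: (@le_lt_trans _ _ ((v + 1) * expR (- s))).
    by rewrite ler_wpM2r ?expR_ge0// lerDl.
  rewrite expRN ltr_pdivrMr ?expR_gt0// -ltr_pdivrMl// mulrC.
  by rewrite (lt_le_trans _ (expR_ge1Dx _))// ltrDr.
rewrite -(ltr_pM2r e0) /kappa => ve; nra.
Qed.

(** * Symmetric measures and odd integrands *)

(** Phrased on sets so as to cover the measure left after removing the margin, which is not given by
    a density. *)
Definition symmetric_measure (R : realType)
    (P : set (measurableTypeR R) -> \bar R) : Prop :=
  forall A, measurable A -> P ((-%R : R -> R) @^-1` A) = P A.

(** Pushing forward along [-%R] shows that the integral is its own negative, and integrability makes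
    it a real number. *)
Lemma symmetric_integral_odd (R : realType)
    (P : probability (measurableTypeR R) R) (f : R -> R) :
    symmetric_measure R P -> P.-integrable setT (EFin \o f) ->
    (forall x, f (- x) = - f x) ->
  (\int[P]_x (f x)%:E = 0)%E.
Proof.
move=> symP intf oddf.
have mf := measurable_int _ intf.
have intfN : P.-integrable setT ((EFin \o f) \o -%R).
  apply: eq_integrable (integrableN intf) => //= x _.
  by rewrite /= oddf EFinN.
have fN : (\int[P]_x (f x)%:E = - \int[P]_x (f x)%:E)%E.
  rewrite -[RHS]integralN//; last exact: integrable_add_def.
  rewrite (_ : (\int[P]_x (- (f x)%:E) = \int[P]_x ((EFin \o f) \o -%R) x)%E); last first.
    by apply: eq_integral => x _; rewrite /= oddf EFinN.
  rewrite -[RHS](@integral_pushforward _ _ (measurableTypeR R)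
    (measurableTypeR R) R -%R _ P setT (EFin \o f))//.
  by apply: eq_measure_integral => A mA _; exact/esym/symP.
move: fN; rewrite -(fineK (integrable_fin_num measurableT intf)).
by move=> -[fN]; congr EFin; move: fN => /=; lra.
Qed.

Lemma density_prob_symmetric (R : realType) (q : density R) :
  (forall x, q (- x) = q x) -> symmetric_measure R (density_prob q).
Proof.
move=> qN A mA; rewrite /density_prob.
transitivity (\int[lebesgue_measure]_(x in -%R @^-1` A) ((EFin \o q) \o -%R) x)%E.
  by apply: eq_integral => x _; rewrite /= qN.
rewrite -(@ge0_integral_pushforward _ _ (measurableTypeR R)
  (measurableTypeR R) R -%R _ lebesgue_measure A (EFin \o q))//.
- by apply: eq_measure_integral => B mB _; exact: lebesgue_measureN.
- by apply/measurable_EFinP/measurable_funTS; exact: density_measurable.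
- by move=> x _; rewrite lee_fin density_ge0.
Qed.

(** * Mass of a symmetric logconcave density near the origin *)

Lemma symmetric_logconcave_nonincr (R : realType) (q : density R) (x y : R) :
  (forall x, q (- x) = q x) -> logconcave q -> 0 <= y <= x -> q x <= q y.
Proof.
move=> qN qlc /andP[y0 yx].
have [x0|x0] := eqVneq x 0.
  by have -> : y = x by apply/eqP; rewrite eq_le yx x0.
have xgt0 : 0 < x by rewrite lt_neqAle eq_sym x0 (le_trans y0).
(* [y] is the convex combination [t x + (1 - t) (- x)] and [q (- x) = q x]. *)
pose t := (1 + y / x) / 2.
have yx0 : 0 <= y / x by rewrite divr_ge0// ltW.
have yx1 : y / x <= 1 by rewrite ler_pdivrMr// mul1r.
have t01 : 0 <= t <= 1 by rewrite /t; lra.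
have := qlc x (- x) t t01.
(* The exponents sum to 1, which settles the side condition of [powRD] even if [q x] is 0. *)
rewrite qN -powRD; last by rewrite addrC subrK oner_eq0.
rewrite addrC subrK powRr1 ?density_ge0//.
by congr (_ <= q _); rewrite /t; field.
Qed.

(** Mass beyond [b] yields a point [x] with [0 < q x]; by monotonicity [q] stays above [q x] on
    [[0, x]], hence on a short interval inside the target set. *)
Lemma density_prob_near0_gt0 (R : realType) (q : density R) (b c : R) :
    (forall x, q (- x) = q x) -> logconcave q -> 0 < b -> 0 < c ->
    (0 < density_prob q `[b, +oo[)%E ->
  (0 < density_prob q [set x : R | (x ^+ 2 <= c)%R])%E.
Proof.
move=> qN qlc b0 c0 qb.
have [x [bx qx]] : exists x, b <= x /\ 0 < q x.
  apply: contrapT => /forallNP H; move: qb.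
  rewrite /density_prob integral0_eq ?ltxx// => x.
  rewrite /= in_itv/= andbT => bx; congr EFin; apply/eqP.
  rewrite eq_le density_ge0 andbT leNgt; apply/negP => qx.
  by apply: (H x).
pose e := Num.min x (Num.sqrt c).
have e0 : 0 < e by rewrite lt_min (lt_le_trans b0)//= sqrtr_gt0.
apply: (@lt_le_trans _ _ (density_prob q `[0, e])); last first.
  apply: le_measure; rewrite ?inE//=.
    exact: measurable_sqr_le.
  move=> y /=; rewrite in_itv/= le_min => /and3P[y0 _ yc].
  rewrite -(sqr_sqrtr (ltW c0)).
  by rewrite ler_pXn2r// nnegrE sqrtr_ge0.
apply: (@lt_le_trans _ _ (\int[lebesgue_measure]_(y in `[0%R, e]) (cst (q x)%:E y))%E).
  rewrite integral_cst//= lebesgue_measure_itv/= lte_fin e0 sube0.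
  by rewrite mule_gt0// lte_fin.
rewrite /density_prob; apply: ge0_le_integral => //=.
- by move=> y _; rewrite lee_fin density_ge0.
- by apply/measurable_EFinP/measurable_funTS; exact: density_measurable.
- move=> y; rewrite in_itv/= le_min lee_fin => /and3P[y0 yx _].
  by apply: symmetric_logconcave_nonincr => //; rewrite y0.
Qed.

(** * The isotropized measure misses a neighbourhood of the origin *)

Section remove_symmetric_margin.
Variables (R : realType) (q : density R) (b : R).
Hypotheses (qN : forall x, q (- x) = q x) (q_iso : isotropic (density_prob q)).
Hypotheses (b_gt0 : 0 < b) (qb : (0 < density_prob q `[b, +oo[)%E).

Let Q := density_prob q.
Let P := remove_margin Q (- b) b.
Let D : set (measurableTypeR R) := ~` `[- b, b].
Let mD : measurable D. Proof. exact: measurable_margin. Qed.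
Let k : R := (fine (Q D))^-1.

(** The complement of the margin contains the right tail; its endpoint [b] carries no mass. *)
Let QD_gt0 : (0 < Q D)%E.
Proof.
apply: (@lt_le_trans _ _ (Q `]b, +oo[)).
  rewrite /Q /density_prob integral_itv_obnd_cbnd//.
  by apply/measurable_EFinP/measurable_funTS; exact: density_measurable.
apply: le_measure; rewrite ?inE//=.
move=> x /=; rewrite /D /= !in_itv/= andbT => bx /andP[_].
by rewrite leNgt bx.
Qed.

Let k_gt0 : 0 < k.
Proof.
by rewrite invr_gt0 fine_gt0// QD_gt0 (le_lt_trans (probability_le1 _ _)) ?ltry.
Qed.

(** The restricted mass is positive and finite, so [mnormalize] does not take its default value. *)
Let PE A : P A = (Q (A `&` D) * k%:E)%E.
Proof.
rewrite /P /remove_margin /= /mnormalize/= /mrestr setTI -/D ifF//.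
by rewrite gt_eqF//= lt_eqF// (le_lt_trans (probability_le1 _ _)) ?ltry.
Qed.

Let intQ2 : (\int[Q]_x (x ^+ 2)%:E = 1)%E.
Proof.
have [E0] := q_iso; rewrite -/Q in E0 *.
rewrite /variance covariance.unlock E0 expectation.unlock => <-.
by apply: eq_integral => x _; rewrite !fctE/= !subr0 expr2.
Qed.

Lemma second_moment_isotropic : Q.-integrable setT (fun x : R => (x ^+ 2)%:E).
Proof.
apply/integrableP; split; first by apply/measurable_EFinP; exact: measurable_funX.
under eq_integral do rewrite gee0_abs ?lee_fin ?sqr_ge0//.
by rewrite intQ2 ltry.
Qed.

(** As a measure, [P] is at most [k] times [Q], whose second moment is 1. *)
Let intP2 : P.-integrable setT (fun x : R => (x ^+ 2)%:E).
Proof.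
have mx2 : measurable_fun [set: measurableTypeR R] (fun x : R => (x ^+ 2)%:E).
  by apply/measurable_EFinP; exact: measurable_funX.
apply/integrableP; split => //.
under eq_integral do rewrite gee0_abs ?lee_fin ?sqr_ge0//.
apply: (@le_lt_trans _ _ (\int[mscale (NngNum (ltW k_gt0)) Q]_x (x ^+ 2)%:E)%E).
  apply: ge0_le_measure_integral => //.
    move=> A mA; rewrite -[leLHS]/(P A) PE /mscale/= muleC lee_pmul2l ?lte_fin//.
    by apply: le_measure; rewrite ?inE//; exact: measurableI.
  by move=> x; rewrite lee_fin sqr_ge0.
rewrite ge0_integral_mscale//; last by move=> x _; rewrite lee_fin sqr_ge0.
by rewrite intQ2 mule1 ltry.
Qed.

(** This is where the assumption [a + b = 0] acts: the removed interval is symmetric. *)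
Let symP : symmetric_measure R P.
Proof.
move=> A mA; rewrite !PE; congr (_ * _)%E.
rewrite -[RHS](density_prob_symmetric _ _ qN); last exact: measurableI.
congr (density_prob q _); rewrite preimage_setI; congr (_ `&` _).
by apply/seteqP; split => x; rewrite /D /= !in_itv/= lerN2 lerNl andbC.
Qed.

Let P_in_margin : P [set x | x ^+ 2 < b ^+ 2] = 0%E.
Proof.
rewrite PE [X in Q X](_ : _ = set0); first by rewrite /Q measure0 mul0e.
apply/seteqP; split => // x [/= xb]; rewrite /D /=; apply.
rewrite in_itv/= -ler_norml -(ler_pXn2r (n := 2))// ?nnegrE ?(ltW b_gt0)//.
by rewrite real_normK ?num_real// ltW.
Qed.

(** The identity is odd, and integrable because [1 + x ^+ 2] dominates it. *)
Let meanP : ('E_P[fun x : R => x] = 0)%E.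
Proof.
rewrite expectation.unlock; apply: symmetric_integral_odd => //.
have int1 : P.-integrable setT (fun x : R => (1 + x ^+ 2)%:E).
  exact: (integrableD measurableT (finite_measure_integrable_cst P 1 measurableT) intP2).
apply: le_integrable int1 => //.
  by apply/measurable_EFinP; exact: measurable_id.
move=> x _; rewrite /= lee_fin.
rewrite [leRHS]ger0_norm ?addr_ge0 ?sqr_ge0//.
by rewrite -(real_normK (num_real x)); have := normr_ge0 x; nra.
Qed.

Let var : R := \int[P]_x (x ^+ 2).

Let varE : fine 'V_P[fun x : R => x] = var.
Proof.
rewrite /variance covariance.unlock meanP expectation.unlock; congr fine.
by apply: eq_integral => x _; rewrite !fctE/= !subr0 expr2.
Qed.

(** [P]-almost everywhere [x ^+ 2] is at least [b ^+ 2], hence so is its mean. *)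
Let var_gt0 : 0 < var.
Proof.
apply: (@lt_le_trans _ _ (b ^+ 2)); first by rewrite exprn_gt0.
have -> : b ^+ 2 = \int[P]_x (b ^+ 2).
  rewrite Rintegral_cst// -[LHS]mulr1; congr (_ * _).
  exact/esym/(congr1 fine (probability_setT P)).
apply: fine_le; rewrite ?integrable_fin_num//.
  by apply: finite_measure_integrable_cst.
apply: ae_ge0_le_integral => //.
- by move=> x _; rewrite lee_fin sqr_ge0.
- by move=> x _; rewrite lee_fin sqr_ge0.
- by apply/measurable_EFinP; exact: measurable_funX.
exists [set x | x ^+ 2 < b ^+ 2]; split => //; first exact: measurable_sqr_lt.
by move=> x /= xb; rewrite ltNge; apply/negP => bx; apply: xb => _; rewrite lee_fin.
Qed.

(** The mean being 0, standardization is division by [Num.sqrt var], which rescales the gap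
    [x ^+ 2 < b ^+ 2]. *)
Lemma isotropize_remove_margin_gap : exists2 c : R, 0 < c &
  isotropize P [set x : R | x ^+ 2 < c] = 0%E.
Proof.
exists (b ^+ 2 / var); first by rewrite divr_gt0// exprn_gt0.
rewrite /isotropize /distribution /pushforward /= -[RHS]P_in_margin.
congr (P _); apply/seteqP; split => x /=;
by rewrite /standardize varE meanP subr0 exprMn exprVn sqr_sqrtr ?(ltW var_gt0)//
  ltr_pM2r// invr_gt0.
Qed.

End remove_symmetric_margin.

(** * Reweighted covariance of a product measure *)

(** The weight factors over the coordinates, and [(l == i) + (l == j)] is the exponent of coordinate
    [l] in the monomial of entry [(i, j)]. *)
Lemma reweighted_cov_product_prob (R : realType) n
    (m : 'I_n -> probability (measurableTypeR R) R) (alpha : R) (i j : 'I_n) :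
    alpha < 0 ->
  reweighted_cov (product_prob m) alpha i j =
    \prod_(l < n) gaussian_moment R (m l) alpha ((l == i) + (l == j)).
Proof.
move=> alpha0; rewrite mxE expectation.unlock.
pose f (l : 'I_n) (x : R) :=
  x ^+ ((l == i) + (l == j)) * expR (alpha * x ^+ 2).
rewrite -[RHS]/(fine (\prod_(l < n) \int[m l]_x f l x)%:E).
rewrite -(integral_product_prob _ _ _ _ m f (1 + (- alpha)^-1)); last 2 first.
- by move=> l; exact: measurable_gaussian_moment.
- by move=> l x; apply: gaussian_moment_bound => //; case: (l == i); case: (l == j).
congr fine; apply: eq_integral => x _; congr EFin.
rewrite !mxE big_ord1 !mxE big_split/= mulrC; congr (_ * _).
  under eq_bigr do rewrite exprD.
  rewrite big_split/=; congr (_ * _).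
    rewrite (bigD1 i)//= eqxx expr1 big1 ?mulr1// => l /negbTE ->.
    by rewrite expr0.
  rewrite (bigD1 j)//= eqxx expr1 big1 ?mulr1// => l /negbTE ->.
  by rewrite expr0.
rewrite /euclidean_norm sqr_sqrtr; last by apply: sumr_ge0 => l _; exact: sqr_ge0.
rewrite mulr_sumr expR_sum; apply: eq_bigr => l _.
by rewrite mxE.
Qed.

(** * Choice of [alpha] and comparison of the diagonal entries *)

Theorem lemma2 (R : realType) (eps : R) (eps_gt0 : 0 < eps)
  (q : density R)
  (q_symmetric : forall x, q (- x) = q x)
  (q_logconcave : logconcave q)
  (q_isotropic : isotropic (density_prob q))
  (a b : R) (a_lt_b : a < b)
  (mass_left : (eps%:E <= density_prob q `]-oo, a])%E)
  (mass_mid : (eps%:E <= density_prob q `[a, b])%E)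
  (mass_right : (eps%:E <= density_prob q `[b, +oo[)%E)
  (d : nat) (d_ge2 : (2 <= d)%N)
  (ab0 : a + b = 0) :
  exists alpha : R, alpha < 0 /\
    let Sigma := reweighted_cov (margin_product q a b d) alpha in
    eigenvalue_nth Sigma 2 < eigenvalue_nth Sigma 1 /\
    is_the_top_eigenvector Sigma (margin_normal R d).
Proof.
have aE : a = - b by apply/eqP; rewrite -addr_eq0 ab0.
have b0 : 0 < b by lra.
have qb : (0 < density_prob q `[b, +oo[)%E.
  by rewrite (lt_le_trans _ mass_right)// lte_fin.
rewrite {a a_lt_b mass_left mass_mid mass_right ab0}aE.
have [c c0 Pc] := isotropize_remove_margin_gap _ _ _ q_symmetric q_isotropic b0 qb.
have c40 : 0 < c / 4 by rewrite divr_gt0.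
have [alpha alpha0 Qc] := gaussian_moment_lt _ _ _ c0
  (second_moment_isotropic _ _ q_isotropic)
  (density_prob_near0_gt0 _ _ _ _ q_symmetric q_logconcave b0 c40 qb).
exists alpha; split => //.
case: d d_ge2 => [|[|n]]// _ Sigma.
set Q := density_prob q in Qc.
set P := isotropize _ in Pc.
pose gP := gaussian_moment R P alpha; pose gQ := gaussian_moment R Q alpha.
have gP0 : 0 < gP 0%N by exact: gaussian_moment0_gt0.
have gQ0 : 0 < gQ 0%N by exact: gaussian_moment0_gt0.
have gQ1 : gQ 1%N = 0.
  rewrite /gQ /gaussian_moment /Rintegral symmetric_integral_odd//.
  - exact: density_prob_symmetric.
  - exact: integrable_gaussian_moment.
  - by move=> x; rewrite !expr1 sqrrN mulNr.
(* The diagonal entries: [lam] at [ord0], where the second moment falls on \hat q, and [mu]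
   elsewhere, where it falls on a copy of q. *)
pose lam := gP 2%N * gQ 0%N ^+ n.+1; pose mu := gP 0%N * (gQ 2%N * gQ 0%N ^+ n).
have mulam : mu < lam.
  (* After cancelling [gQ 0 ^+ n]: [gP 0 * gQ 2 < c * gP 0 * gQ 0 <= gP 2 * gQ 0]. *)
  rewrite /mu /lam exprS !mulrA ltr_pM2r ?exprn_gt0//.
  have := gaussian_moment_ge _ _ _ _ alpha0 (ltW c0) Pc; rewrite -!/(gP _).
  move: Qc; rewrite -!/(gQ _) => Qc Pc'; nra.
suff -> : Sigma = diag_mx (\row_(i < n.+2) if i == 0%N :> nat then lam else mu).
  exact: margin_normal_top_eigenvector.
apply/matrixP => i j; rewrite reweighted_cov_product_prob// !mxE big_ord_recl/=.
rewrite -/P -/Q.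
(* Two distinct indices include one other than [ord0]; it contributes the factor [gQ 1 = 0], so the
   off-diagonal entries vanish. *)
case: (unliftP ord0 i) => [i' ->|->]; case: (unliftP ord0 j) => [j' ->|->] /=.
- have [->|ij] := eqVneq i' j'.
    rewrite eqxx mulr1n; congr (_ * _).
    rewrite (bigD1 j')//= eqxx; congr (_ * _).
    rewrite (eq_bigr (fun=> gQ 0%N)) => [|l lj].
      by rewrite prodr_const cardC1 card_ord.
    by rewrite (inj_eq lift_inj) (negbTE lj).
  rewrite (inj_eq lift_inj) (negbTE ij) mulr0n (bigD1 i')//= eqxx.
  by rewrite (inj_eq lift_inj) (negbTE ij) -/(gQ 1%N) gQ1 mul0r mulr0.
- by rewrite (bigD1 i')//= eqxx -/(gQ 1%N) gQ1 mul0r mulr0.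
- by rewrite (bigD1 j')//= eqxx -/(gQ 1%N) gQ1 mul0r mulr0.
rewrite mulr1n; congr (_ * _).
by rewrite prodr_const card_ord.
Qed.
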